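(* If $\Sigma\subset N$ is a rational fan, then $Y_\Sigma=X_\Sigma(\mathbb{R}_\geq)$, that is, the irrational toric variety $Y_\Sigma$ is the nonnegative part of the classical toric variety $X_\Sigma$, the sets being identified by restricting monoid homomorphisms from $\sigma^\vee$ to $\sigma^\vee\cap M_{\mathbb{Z}}$ for each cone $\sigma\in\Sigma$.
   Context: $N_{\mathbb{Z}}$ is a free abelian group of finite rank, $M_{\mathbb{Z}}=\mathrm{Hom}(N_{\mathbb{Z}},\mathbb{Z})$, $N=N_{\mathbb{Z}}\otimes\mathbb{R}$ and $M=M_{\mathbb{Z}}\otimes\mathbb{R}$, with pairing $u\cdot v$; $\mathbb{R}_\geq$ is the set of nonnegative reals. A polyhedral cone is a set $\mathbb{R}_\geq v_1+\dots+\mathbb{R}_\geq v_k$; it is rational if the $v_i$ may be chosen in the lattice. The dual of a cone $\sigma\subset N$ is $\sigma^\vee=\{u\in M\mid u\cdot v\geq0\ \forall v\in\sigma\}$. A face of $\sigma$ is a set $\{v\in\sigma\mid u\cdot v=0\}$ with $u\in\sigma^\vee$, and similarly for cones in $M$. A fan $\Sigma\subset N$ is a finite collection of polyhedral cones in $N$ closed under taking faces such that any two of its cones meet in a common face; it is rational if all of its cones are rational. For a polyhedral cone $C\subset M$, $\mathrm{Hom}_c(C,\mathbb{R}_\geq)$ is the set of monoid homomorphisms $\varphi\colon(C,+)\to(\mathbb{R}_\geq,\times)$ (so $\varphi(0)=1$) that are continuous on the relative interior of each face of $C$. For $\sigma\in\Sigma$ put $V_\sigma=\mathrm{Hom}_c(\sigma^\vee,\mathbb{R}_\geq)$.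 For $\tau$ a face of $\sigma$, restriction from $\tau^\vee$ to $\sigma^\vee$ gives an inclusion $V_\tau\hookrightarrow V_\sigma$. The irrational toric variety $Y_\Sigma=\bigcup_{\sigma\in\Sigma}V_\sigma$ is obtained by gluing the $V_\sigma$ along these inclusions. For $\sigma\in\Sigma$ rational, $S_\sigma=\sigma^\vee\cap M_{\mathbb{Z}}$, and $\mathrm{Hom}_{\mathrm{mon}}(S_\sigma,\mathbb{R}_\geq)$ is the set of monoid homomorphisms from $(S_\sigma,+)$ to $(\mathbb{R}_\geq,\times)$. $X_\Sigma(\mathbb{R}_\geq)$, the nonnegative part of the toric variety $X_\Sigma$, is obtained by gluing the sets $\mathrm{Hom}_{\mathrm{mon}}(S_\sigma,\mathbb{R}_\geq)$, $\sigma\in\Sigma$, along the restriction inclusions $\mathrm{Hom}_{\mathrm{mon}}(S_\tau,\mathbb{R}_\geq)\hookrightarrow\mathrm{Hom}_{\mathrm{mon}}(S_\sigma,\mathbb{R}_\geq)$ for $\tau$ a face of $\sigma$. *)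

(* Defs.v *)
From HB Require Import structures.
From Stdlib Require Import Relation_Operators.
From mathcomp Require Import all_boot all_order all_algebra generic_quotient.
From mathcomp Require Import all_classical all_reals topology normedtype.

Set Implicit Arguments.
Unset Strict Implicit.
Unset Printing Implicit Defensive.

Import Order.TTheory GRing.Theory Num.Theory.
Import numFieldNormedType.Exports.

Local Open Scope classical_set_scope.
Local Open Scope ring_scope.
Local Open Scope quotient_scope.

(* A basis of the lattice N_Z is fixed, so that N_Z = Z^n and N = R^n; the dual
   basis gives M_Z = Z^n and M = R^n, with the pairing in coordinates. Both N
   and M are 'rV[R]_n, so that duals, faces, etc. are defined once for both. *)

Section Cones.
Variables (R : realType) (n : nat).
Implicit Types (C F : set 'rV[R]_n).

Definition pairing (u v : 'rV[R]_n) : R := \sum_(i < n) u 0 i * v 0 i.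

Definition lattice : set 'rV[R]_n := [set v | forall i, v 0 i \is a Num.int].

Definition cone_of k (v : 'I_k -> 'rV[R]_n) : set 'rV[R]_n :=
  [set x | exists2 c : 'I_k -> R,
     forall i, 0 <= c i & x = \sum_(i < k) c i *: v i].

Definition polyhedral_cone C : Prop :=
  exists (k : nat) (v : 'I_k -> 'rV[R]_n), C = cone_of v.

Definition rational_cone C : Prop :=
  exists k, exists2 v : 'I_k -> 'rV[R]_n,
    forall i, lattice (v i) & C = cone_of v.

Definition dual C : set 'rV[R]_n :=
  [set u | forall v, C v -> 0 <= pairing u v].

Definition is_face F C : Prop :=
  exists2 u, dual C u & F = [set v | C v /\ pairing u v = 0].

Definition affine_hull C : set 'rV[R]_n :=
  [set x | exists k (a : 'I_k -> 'rV[R]_n) (c : 'I_k -> R),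
     [/\ forall i, C (a i), \sum_(i < k) c i = 1
       & x = \sum_(i < k) c i *: a i]].

Definition relint C : set 'rV[R]_n :=
  [set x | C x /\ within (affine_hull C) (nbhs x) C].

Record fan (Sigma : set (set 'rV[R]_n)) : Prop := Fan {
  fan_finite : finite_set Sigma;
  fan_polyhedral : forall s, Sigma s -> polyhedral_cone s;
  fan_face : forall s t, Sigma s -> is_face t s -> Sigma t;
  fan_meet : forall s t, Sigma s -> Sigma t ->
    is_face (s `&` t) s /\ is_face (s `&` t) t }.

Record rational_fan (Sigma : set (set 'rV[R]_n)) : Prop := RationalFan {
  rational_fan_fan : fan Sigma;
  rational_fan_cone : forall s, Sigma s -> rational_cone s }.

(* Homomorphisms from the submonoid S of M to the multiplicative monoid of
   nonnegative reals. They are functions on the subtype S only, so that equality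
   of homomorphisms is pointwise equality on S. *)
Definition hom_mon (S : set 'rV[R]_n) : set (S -> R) :=
  [set phi | [/\ forall x, 0 <= phi x,
     forall x, set_val x = 0 -> phi x = 1 &
     forall x y z, set_val z = set_val x + set_val y ->
       phi z = phi x * phi y]].

Definition hom_c C : set (C -> R) :=
  [set phi | hom_mon phi /\ forall F, is_face F C ->
     {within (@set_val _ C) @^-1` relint F, continuous phi}].

(* psi is the restriction of phi when S `<=` S'. *)
Definition is_restriction (S S' : set 'rV[R]_n) (phi : S' -> R) (psi : S -> R) :
    Prop :=
  forall (x : S) (y : S'), set_val x = set_val y -> psi x = phi y.

End Cones.

Arguments lattice {R n}.
Arguments hom_mon {R n} S.
Arguments hom_c {R n} C.

Section Gluing.
Variables (T : Type) (r : T -> T -> Prop).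

Definition glue_rel : rel {classic T} :=
  fun x y => `[< clos_refl_sym_trans T r x y >].

Lemma glue_rel_refl : reflexive glue_rel.
Proof. by move=> x; apply/asboolP; exact: rst_refl. Qed.

Lemma glue_rel_sym : symmetric glue_rel.
Proof. by move=> x y; apply/asboolP/asboolP; exact: rst_sym. Qed.

Lemma glue_rel_trans : transitive glue_rel.
Proof.
by move=> y x z /asboolP xy /asboolP yz; apply/asboolP; exact: rst_trans xy yz.
Qed.

Canonical glue_equiv := EquivRel glue_rel glue_rel_refl glue_rel_sym glue_rel_trans.

Definition glued : Type := {eq_quot glue_rel}.

Definition glue_in (x : T) : glued := \pi_{eq_quot glue_rel} (x : {classic T}).

End Gluing.

Section ToricVarieties.
Variables (R : realType) (n : nat).
Implicit Types (s : set 'rV[R]_n) (Sigma : set (set 'rV[R]_n)).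

Definition Vchart s : set (dual s -> R) := hom_c (dual s).
Arguments Vchart s : clear implicits.

Definition Ssemigroup s : set 'rV[R]_n := dual s `&` lattice.

Definition Xchart s : set (Ssemigroup s -> R) := hom_mon (Ssemigroup s).
Arguments Xchart s : clear implicits.

Definition Vpoints Sigma : Type := {s : Sigma & Vchart (set_val s)}.

Definition Xpoints Sigma : Type := {s : Sigma & Xchart (set_val s)}.

Definition Vglue Sigma (p q : Vpoints Sigma) : Prop :=
  is_face (set_val (tag p)) (set_val (tag q)) /\
  is_restriction (set_val (tagged p)) (set_val (tagged q)).

Definition Xglue Sigma (p q : Xpoints Sigma) : Prop :=
  is_face (set_val (tag p)) (set_val (tag q)) /\
  is_restriction (set_val (tagged p)) (set_val (tagged q)).

Definition irrational_toric_variety Sigma : Type := glued (@Vglue Sigma).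

Definition nonneg_toric_variety Sigma : Type := glued (@Xglue Sigma).

Definition Vin Sigma (s : Sigma) (phi : Vchart (set_val s)) :
    irrational_toric_variety Sigma :=
  glue_in (@Vglue Sigma)
    (existT (fun s : Sigma => Vchart (set_val s) : Type) s phi).

Definition Xin Sigma (s : Sigma) (psi : Xchart (set_val s)) :
    nonneg_toric_variety Sigma :=
  glue_in (@Xglue Sigma)
    (existT (fun s : Sigma => Xchart (set_val s) : Type) s psi).

Lemma Ssemigroup_sub s x : x \in Ssemigroup s -> x \in dual s.
Proof. by move=> /set_mem[xs _]; exact: mem_set. Qed.

Definition Ssemigroup_incl s (x : Ssemigroup s) : dual s :=
  exist _ (set_val x) (Ssemigroup_sub (valP x)).

Lemma restrict_hom_mon s (phi : Vchart s) :
  (set_val phi \o @Ssemigroup_incl s) \in Xchart s.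
Proof.
have [[phi_ge0 phi0 phiD] _] := set_mem (valP phi).
apply: mem_set; split => [x | x x0 | x y z zxy] /=.
- exact: phi_ge0.
- exact: phi0.
- exact: phiD.
Qed.

Definition restrict_lattice s (phi : Vchart s) : Xchart s :=
  exist _ (set_val phi \o @Ssemigroup_incl s) (restrict_hom_mon phi).

End ToricVarieties.

Arguments Vchart {R n} s.
Arguments Xchart {R n} s.
Arguments irrational_toric_variety {R n} Sigma.
Arguments nonneg_toric_variety {R n} Sigma.

(* Main.v *)
Require Import Defs.
From Stdlib Require Import Relation_Operators.
From mathcomp Require Import all_boot all_order all_algebra.
From mathcomp Require Import all_classical all_reals topology normedtype.
From mathcomp Require Import sequences exp ring lra.

(** Everything rests on one fact: for a rational cone s, restriction to lattice
    points is a bijection from Hom_c(s^vee) to Hom_mon(S_s).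

    Since s is rational, every point of s^vee is a nonnegative real combination
    of points of S_s ([dual_cone_hull_lattice]): the smallest face through the
    point spans a rational subspace, so the point can be written with rational
    points of that face.

    Injectivity. A homomorphism on s^vee is thus determined by its values along
    the rays t g with g in S_s and t > 0. Such an open ray lies in the relative
    interior of a single face ([relint_ray]), so the homomorphism is continuous
    along it; for rational t = m/d its value at t g is the d-th root of its
    value at the lattice point m g, and continuity gives the other t. The
    argument compares two homomorphisms on possibly different duals
    s^vee inside t^vee ([hom_c_eq_on_dual]), and so it also shows that the
    gluing relations of the two varieties correspond.

    Surjectivity. Let psi be a homomorphism on S_s and P the set of lattice
    points where it is positive. On the monoid P the function ln psi is
    additive, hence the restriction of a real linear form w
    ([additive_on_lattice_linear]). The extension is exp(w x) on the real cone
    generated by P and 0 elsewhere. It is multiplicative because that cone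
    absorbs summands: if x + y lies in it then so does x ([cone_hull_face]).
    For the same reason the relative interior of a face of s^vee lies either
    inside the cone or outside of it, which gives the continuity
    ([hom_c_extension]).

    The bijections of charts respect the gluing relations in both directions,
    so they induce a bijection of the quotients ([glued_bij]). *)

Set Implicit Arguments.
Unset Strict Implicit.
Unset Printing Implicit Defensive.

Import Order.TTheory GRing.Theory Num.Theory.
Import numFieldNormedType.Exports.

Local Open Scope classical_set_scope.
Local Open Scope ring_scope.

(** * The pairing and dual cones *)

Section Pairing.
Variables (R : realType) (n : nat).
Implicit Types (u v w x y : 'rV[R]_n) (a : R).

Lemma pairing_mulmx u v : pairing u v = (u *m v^T) 0 0.
Proof. by rewrite mxE; apply: eq_bigr => i _; rewrite mxE. Qed.

Lemma pairingC u v : pairing u v = pairing v u.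
Proof. by apply: eq_bigr => i _; rewrite mulrC. Qed.

Lemma pairing0r u : pairing u 0 = 0.
Proof. by rewrite pairing_mulmx trmx0 mulmx0 mxE. Qed.

Lemma pairingDr u v w : pairing u (v + w) = pairing u v + pairing u w.
Proof. by rewrite !pairing_mulmx linearD mulmxDr mxE. Qed.

Lemma pairingZr u a v : pairing u (a *: v) = a * pairing u v.
Proof. by rewrite !pairing_mulmx linearZ -scalemxAr mxE. Qed.

Lemma pairingNr u v : pairing u (- v) = - pairing u v.
Proof. by rewrite -scaleN1r pairingZr mulN1r. Qed.

Lemma pairing_sumr u I (r : seq I) (P : pred I) (F : I -> 'rV[R]_n) :
  pairing u (\sum_(i <- r | P i) F i) = \sum_(i <- r | P i) pairing u (F i).
Proof. by apply: big_morph; [exact: pairingDr | exact: pairing0r]. Qed.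

Lemma pairing_suml u I (r : seq I) (P : pred I) (F : I -> 'rV[R]_n) :
  pairing (\sum_(i <- r | P i) F i) u = \sum_(i <- r | P i) pairing (F i) u.
Proof.
by rewrite pairingC pairing_sumr; apply: eq_bigr => i _; rewrite pairingC.
Qed.

Lemma dual_cone_of k (v : 'I_k -> 'rV[R]_n) x :
  dual (cone_of v) x <-> forall j, 0 <= pairing (v j) x.
Proof.
split=> [dx j | vx y [c c_ge0 ->]].
  rewrite pairingC; apply: dx; exists (fun i => (i == j)%:R) => [i|].
    by case: eqP.
  rewrite (bigD1 j) //= eqxx scale1r big1 ?addr0 // => i /negPf ->.
  by rewrite scale0r.
rewrite pairing_sumr; apply: sumr_ge0 => i _.
by rewrite pairingZr mulr_ge0 // pairingC.
Qed.

Lemma dual0 (C : set 'rV[R]_n) : dual C 0.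
Proof. by move=> v _; rewrite pairingC pairing0r. Qed.

Lemma dualD (C : set 'rV[R]_n) x y : dual C x -> dual C y -> dual C (x + y).
Proof.
move=> dx dy v Cv; rewrite pairingC pairingDr addr_ge0 // pairingC.
  exact: dx.
exact: dy.
Qed.

Lemma dualZ (C : set 'rV[R]_n) a x : 0 <= a -> dual C x -> dual C (a *: x).
Proof.
by move=> a0 dx v Cv; rewrite pairingC pairingZr mulr_ge0 // pairingC; apply: dx.
Qed.

Lemma dualS (C D : set 'rV[R]_n) : C `<=` D -> dual D `<=` dual C.
Proof. by move=> CD x dx v /CD; exact: dx. Qed.

End Pairing.

(** * Lattice and rational vectors *)

Section Lattice.
Variables (R : realType) (n : nat).
Implicit Types (x y : 'rV[R]_n).

Lemma lattice0 : lattice (0 : 'rV[R]_n).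
Proof. by move=> i; rewrite mxE rpred0. Qed.

Lemma latticeD x y : lattice x -> lattice y -> lattice (x + y).
Proof. by move=> lx ly i; rewrite mxE rpredD. Qed.

Lemma latticeN x : lattice x -> lattice (- x).
Proof. by move=> lx i; rewrite mxE rpredN. Qed.

Lemma latticeZnat (N : nat) x : lattice x -> lattice (N%:R *: x).
Proof. by move=> lx i; rewrite mxE rpredM // rpred_nat. Qed.

Definition ratv (q : 'rV[rat]_n) : 'rV[R]_n := map_mx ratr q.

Lemma ratvD q q' : ratv (q + q') = ratv q + ratv q'.
Proof. exact: map_mxD. Qed.

Lemma ratvZ (c : rat) q : ratv (c *: q) = ratr c *: ratv q.
Proof. exact: map_mxZ. Qed.

Lemma ratv_sum I (r : seq I) (P : pred I) (F : I -> 'rV[rat]_n) :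
  ratv (\sum_(i <- r | P i) F i) = \sum_(i <- r | P i) ratv (F i).
Proof. exact: map_mx_sum. Qed.

Lemma lattice_ratv x : lattice x -> exists q, x = ratv q.
Proof.
move=> lx; exists (\row_i (Num.floor (x 0 i))%:~R); apply/rowP => i.
by rewrite !mxE ratr_int floorK // lx.
Qed.

Lemma common_denominator k (q : 'rV[rat]_k) :
  exists2 N : nat, (0 < N)%N &
  exists z : 'I_k -> int, forall i, N%:R * q 0 i = (z i)%:~R.
Proof.
exists (\prod_i `|denq (q ord0 i)|)%N.
  by apply: prodn_gt0 => i; rewrite absz_gt0.
exists (fun i => numq (q 0 i) * (\prod_(j | j != i) `|denq (q ord0 j)|)%N) => i.
rewrite intrM numqE (bigD1 i) //= natrM -[in RHS]pmulrn.
rewrite -[X in _ = _ * X * _]/((denq (q 0 i))%:~R).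
by rewrite -{2}[denq _]gez0_abs // -pmulrn mulrC mulrA.
Qed.

Lemma ratv_scale_lattice q :
  exists2 N : nat, (0 < N)%N & lattice (N%:R *: ratv q).
Proof.
have [N N0 [z zE]] := common_denominator q; exists N => // i.
by rewrite !mxE -[N%:R](@ratr_nat R) -rmorphM zE /= ratr_int intr_int.
Qed.

End Lattice.

(** * Generation of the dual of a rational cone by lattice points *)

Section ConeHull.
Variables (R : realType) (n : nat).
Implicit Types (P : set 'rV[R]_n) (x y p : 'rV[R]_n).

(** Inductive, so that a statement about a homomorphism on the real cone
    generated by [P] is proved by adding one multiple of a generator at a
    time. *)
Inductive cone_hull P : 'rV[R]_n -> Prop :=
| cone_hull0 : cone_hull P 0
| cone_hull_step a p x :
    0 <= a -> P p -> cone_hull P x -> cone_hull P (a *: p + x).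

Lemma sub_cone_hull P p : P p -> cone_hull P p.
Proof.
move=> Pp; rewrite -[p]addr0 -[p in p + _]scale1r.
by apply: cone_hull_step => //; exact: cone_hull0.
Qed.

Lemma cone_hullD P x y : cone_hull P x -> cone_hull P y -> cone_hull P (x + y).
Proof.
move=> Px Py; elim: Px => [|a p z a0 Pp _ IH]; first by rewrite add0r.
by rewrite -addrA; exact: cone_hull_step.
Qed.

Lemma cone_hullZ P a x : 0 <= a -> cone_hull P x -> cone_hull P (a *: x).
Proof.
move=> a0; elim=> [|b p z b0 Pp _ IH]; first by rewrite scaler0; exact: cone_hull0.
by rewrite scalerDr scalerA; apply: cone_hull_step => //; exact: mulr_ge0.
Qed.

Lemma cone_hull_sum P I (r : seq I) (F : I -> 'rV[R]_n) :
  (forall i, cone_hull P (F i)) -> cone_hull P (\sum_(i <- r) F i).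
Proof.
by move=> PF; elim/big_ind: _ => // [|x y]; [exact: cone_hull0|exact: cone_hullD].
Qed.

Lemma cone_hull_ratv (s : set 'rV[R]_n) (q : 'rV[rat]_n) :
  dual s (ratv R q) -> cone_hull (Ssemigroup s) (ratv R q).
Proof.
move=> dq; have [N N0 lN] := ratv_scale_lattice R q.
have N0' : (N%:R : R) != 0 by rewrite pnatr_eq0 -lt0n.
rewrite -[ratv R q]scale1r -(mulVf N0') -scalerA.
apply: cone_hullZ; first by rewrite invr_ge0.
by apply: sub_cone_hull; split => //; exact: dualZ.
Qed.

Lemma cone_hull_Ssemigroup_dual (s : set 'rV[R]_n) x :
  cone_hull (Ssemigroup s) x -> dual s x.
Proof.
elim=> [|a g z a0 [dg _] _ dz]; first exact: dual0.
by apply: dualD => //; exact: dualZ.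
Qed.

Lemma ratr_approx_below (c e : R) : 0 < e ->
  exists q : rat, 0 <= c - ratr q <= e.
Proof.
move=> e0; have /rat_in_itvoo[q] : c - e < c by rewrite ltrBlDr ltrDl.
rewrite in_itv /= => /andP[q1 q2]; exists q.
by rewrite subr_ge0 (ltW q2) /= lerBlDl -lerBlDr ltW.
Qed.

(** The vectors orthogonal to those [v j] that are orthogonal to [x] form the
    kernel of a rational matrix. The kernel of a matrix is computed by the same
    formulas over the rationals and over the reals, so its real kernel is
    spanned by rational vectors. *)
Lemma orthogonal_rational_span k (v : 'I_k -> 'rV[R]_n) x :
  (forall j, lattice (v j)) ->
  exists (b : 'I_n -> 'rV[rat]_n) (c : 'I_n -> R),
    x = \sum_i c i *: ratv R (b i) /\
    forall j i, pairing (v j) x = 0 -> pairing (v j) (ratv R (b i)) = 0.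
Proof.
move=> lv; have /choice[w vE] j := lattice_ratv (lv j).
(* The rows of W not orthogonal to x are replaced by 0. *)
pose W := \matrix_(j < k) if pairing (v j) x == 0 then w j else 0.
have pW y j : (y *m (map_mx (@ratr R) W)^T) 0 j =
    if pairing (v j) x == 0 then pairing (v j) y else 0.
  rewrite mxE; case: ifP => vx; last first.
    by apply: big1 => i _; rewrite !mxE vx mxE rmorph0 mulr0.
  by apply: eq_bigr => i _; rewrite mxE mxE mxE vx vE mxE mulrC.
have : (x <= map_mx (@ratr R) (kermx W^T))%MS.
  rewrite map_kermx sub_kermx -map_trmx; apply/eqP/rowP => j.
  by rewrite pW mxE; case: eqP.
move=> /submxP[c xE].
exists (fun i => row i (kermx W^T)), (fun i => c 0 i); split.
  by rewrite xE mulmx_sum_row; apply: eq_bigr => i _; rewrite /ratv map_row.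
move=> j i vx0; have := pW (ratv R (row i (kermx W^T))) j; rewrite vx0 eqxx => <-.
rewrite /ratv map_trmx -map_mxM -row_mul mulmx_ker.
by rewrite row0 map_mx0 mxE.
Qed.

(** Let [B i] be rational vectors spanning the directions orthogonal to every
    [v j] with [pairing (v j) x = 0], and x = sum_i c_i B_i. For a rational
    approximation y = sum_i q_i B_i of x with q_i <= c_i and a large integer M,
      x = sum_i (c_i - q_i) (B_i + M y) + (1 - M sum_i (c_i - q_i)) y
    writes x as a nonnegative combination of rational points of the dual:
    M is chosen first, so large that B_i + M y pairs nonnegatively with the
    [v j] as soon as y is close to x, and then y so close to x that the last
    coefficient is nonnegative. *)
Lemma dual_cone_hull_lattice (s : set 'rV[R]_n) :
  rational_cone s -> dual s `<=` cone_hull (Ssemigroup s).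
Proof.
move=> [k [v lv ->]] x; move: (cone_of v) (@dual_cone_of R n k v) => s' dualP dx.
have vx_ge0 := (dualP x).1 dx.
have [b [c [xE bx0]]] := orthogonal_rational_span x lv.
pose B i := ratv R (b i).
(* When v j is orthogonal to x the quotient is 0, and M need only work for the
   other j. *)
pose t i j := 2 * `|pairing (v j) (B i)| / pairing (v j) x.
have t_ge0 i j : 0 <= t i j by rewrite !mulr_ge0 // invr_ge0.
pose M := (\sum_i \sum_j Num.bound (t i j)).+1.
have tM i j : t i j <= M%:R.
  apply: ltW; apply: lt_le_trans (archi_boundP (t_ge0 i j)) _.
  rewrite ler_nat /M (bigD1 i) //= (bigD1 j) //=.
  by rewrite -addnA -addnS leq_addr.
have vBM i j : 2 * `|pairing (v j) (B i)| <= M%:R * pairing (v j) x.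
  have [/bx0 vB0|vx] := eqVneq (pairing (v j) x) 0.
    by rewrite /B vB0 normr0 mulr0 mulr_ge0.
  by rewrite -ler_pdivrMr ?lt_def ?vx ?vx_ge0 //; exact: tM.
(* With 0 <= c i - q i <= e these differences sum to at most 1 / M, which makes
   the last coefficient nonnegative and <v j, y> at least <v j, x> / 2. *)
pose e : R := (M * n.+1)%:R^-1.
have e0 : 0 < e by rewrite invr_gt0 ltr0n.
have /choice[q qP] i := ratr_approx_below (c i) e0.
pose eps i := c i - ratr (q i).
have eps_ge0 i : 0 <= eps i by have /andP[] := qP i.
have sum_eps : M%:R * (\sum_i eps i) <= 1.
  apply: (@le_trans _ _ (M%:R * \sum_(i < n) e)).
    by rewrite ler_wpM2l // ler_sum // => i _; have /andP[] := qP i.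
  rewrite sumr_const card_ord -[e *+ n]mulr_natr mulrCA mulrC -natrM /e.
  by rewrite ler_pdivrMr ?ltr0n // mul1r ler_nat leq_pmul2l.
pose y := \sum_i q i *: b i.
have yE : ratv R y = \sum_i ratr (q i) *: B i.
  by rewrite ratv_sum; apply: eq_bigr => i _; rewrite ratvZ.
have xyE : x - ratv R y = \sum_i eps i *: B i.
  by rewrite xE yE -sumrB; apply: eq_bigr => i _; rewrite -scalerBl.
have vy j : pairing (v j) x <= 2 * pairing (v j) (ratv R y).
  have : pairing (v j) (x - ratv R y) <= pairing (v j) x / 2.
    rewrite xyE pairing_sumr.
    apply: (@le_trans _ _ (\sum_i eps i * (M%:R * pairing (v j) x / 2))).
      apply: ler_sum => i _; rewrite pairingZr ler_wpM2l //.
      by have := vBM i j; have := ler_norm (pairing (v j) (B i)); lra.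
    rewrite -mulr_suml -mulrA mulrA [_ * M%:R]mulrC.
    by apply: ler_piMl => //; rewrite divr_ge0.
  rewrite pairingDr pairingNr; lra.
have dy : dual s' (ratv R y).
  by apply/dualP => j; have := vy j; have := vx_ge0 j; lra.
have dBy i : dual s' (ratv R (b i + M%:R *: y)).
  apply/dualP => j; rewrite ratvD ratvZ ratr_nat pairingDr pairingZr.
  have M0 : 0 <= M%:R :> R by [].
  have := vBM i j; have := ler_norm (- pairing (v j) (B i)); rewrite normrN.
  by have := ler_wpM2l M0 (vy j); rewrite /B; lra.
have -> : x = \sum_i eps i *: ratv R (b i + M%:R *: y)
              + (1 - M%:R * \sum_i eps i) *: ratv R y.
  rewrite -[LHS](subrK (ratv R y)) xyE scalerBl scale1r.
  under [in RHS]eq_bigr => i _.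
    rewrite ratvD scalerDr ratvZ ratr_nat scalerA; over.
  rewrite big_split /= -scaler_suml -mulr_suml [_ * M%:R]mulrC addrACA.
  by rewrite subrr addr0 -/B.
apply: cone_hullD.
  by apply: cone_hull_sum => i; apply: cone_hullZ => //; exact: cone_hull_ratv.
by apply: cone_hullZ; [rewrite subr_ge0 | exact: cone_hull_ratv].
Qed.

End ConeHull.

(** * Additive functions on lattice monoids *)

Section LinearExtension.
Variables (R : realType) (n : nat).
Implicit Types (P : set 'rV[R]_n).

(** The number of linearly independent vectors of [P] is bounded by [n]. A
    largest such family spans [P] already over the rationals, which is what lets
    a mere additive function be controlled by its values on the family. *)
Lemma maximal_free_rows P : (forall p, P p -> lattice p) ->
  exists r (B : 'M[rat]_(r, n)), [/\ row_free B,
    forall i, P (ratv R (row i B)) &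
    forall q, P (ratv R q) -> (q <= B)%MS].
Proof.
move=> lP.
pose Q r := `[< exists2 B : 'M[rat]_(r, n), row_free B &
                  forall i, P (ratv R (row i B)) >].
have exQ : exists r, Q r.
  exists 0; apply/asboolP; exists 0; last by case.
  by rewrite /row_free mxrank0.
have Qle r : Q r -> (r <= n)%N.
  by move=> /asboolP[B /eqP rB _]; have := rank_leq_col B; rewrite rB.
case: (ex_maxnP exQ Qle) => r /asboolP[B freeB PB] maxr.
exists r, B; split=> // q Pq; apply: contraT => qB.
suff /maxr : Q (1 + r)%N by rewrite ltnn.
apply/asboolP; exists (col_mx q B) => [|i]; last first.
  rewrite -[i]splitK; case: (fintype.split i) => j /=.
    by rewrite rowKu row_id.
  by rewrite rowKd.
rewrite /row_free eqn_leq rank_leq_row -addsmxE add1n /=.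
suff : (B < q + B)%MS by rewrite ltmxErank (eqP freeB) => /andP[].
by rewrite ltmxE addsmxSr; apply: contra qB; apply: submx_trans; exact: addsmxSl.
Qed.

(** Prescribe [w] on a maximal independent family [b] in [P]. The difference
    [mu] between [lam] and the linear form is additive on [P] and vanishes on
    [b]. A point [p] of [P] is a rational combination of [b], so clearing
    denominators and moving the negative terms to the other side gives an
    identity N p + sum_i z-_i b_i = sum_i z+_i b_i inside the monoid [P], whence
    N mu(p) = 0. *)
Lemma additive_on_lattice_linear P (lam : 'rV[R]_n -> R) :
  (forall p, P p -> lattice p) -> P 0 ->
  (forall p q, P p -> P q -> P (p + q)) ->
  (forall p q, P p -> P q -> lam (p + q) = lam p + lam q) ->
  exists w, forall p, P p -> lam p = pairing w p.
Proof.
move=> lP P0 PD lamD.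
have [r [B [freeB PB maxB]]] := maximal_free_rows lP.
pose b i := ratv R (row i B).
pose BR : 'M[R]_(r, n) := map_mx (@ratr R) B.
pose w : 'rV[R]_n := (pinvmx BR *m \col_i lam (b i))^T.
have wb i : pairing w (b i) = lam (b i).
  have : BR *m w^T = \col_i lam (b i).
    by rewrite trmxK mulmxA mulmxVp ?mul1mx // row_free_map.
  move=> /matrixP/(_ i 0); rewrite [in RHS]mxE => <-.
  by rewrite mxE pairingC; apply: eq_bigr => j _; rewrite !mxE.
exists w => p Pp; apply/eqP; rewrite -subr_eq0; apply/eqP.
pose mu x := lam x - pairing w x.
have muD x y : P x -> P y -> mu (x + y) = mu x + mu y.
  by move=> Px Py; rewrite /mu lamD // pairingDr; ring.
have mu0 : mu 0 = 0.
  have := muD _ _ P0 P0; rewrite addr0 => mu2.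
  by apply: (addrI (mu 0)); rewrite -mu2 addr0.
have muN x N : P x -> P (x *+ N) /\ mu (x *+ N) = mu x *+ N.
  move=> Px; elim: N => [|N [PN muN]]; first by rewrite !mulr0n.
  by rewrite !mulrS; split; [exact: PD | rewrite muD // muN].
have mub (z : 'I_r -> nat) :
    P (\sum_i b i *+ z i) /\ mu (\sum_i b i *+ z i) = 0.
  elim/big_ind: _ => // [x y [Px mux] [Py muy]|i _].
    by split; [exact: PD | rewrite muD // mux muy addr0].
  have [PN ->] := muN _ (z i) (PB i); split=> //.
  by rewrite /mu wb subrr mul0rn.
have [q pE] := lattice_ratv (lP _ Pp).
have /submxP[d qE] : (q <= B)%MS by apply: maxB; rewrite -pE.
have [N N0 [z zE]] := common_denominator d.
(* The positive and negative parts of the integer z i. *)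
pose zp i := if z i is Posz m then m else 0%N.
pose zn i := if z i is Negz m then m.+1 else 0%N.
have zpn i : (z i)%:~R = (zp i)%:R - (zn i)%:R :> R.
  by rewrite /zp /zn; case: (z i) => m; rewrite ?subr0 ?sub0r // NegzE mulrNz.
have NpE : p *+ N + \sum_i b i *+ zn i = \sum_i b i *+ zp i.
  have -> : p *+ N = \sum_i (b i *+ zp i - b i *+ zn i).
    rewrite pE qE mulmx_sum_row ratv_sum -sumrMnl; apply: eq_bigr => i _.
    rewrite ratvZ -scaler_nat scalerA -[N%:R](ratr_nat R) -rmorphM zE /=.
    by rewrite ratr_int zpn scalerBl !scaler_nat.
  by rewrite -big_split /=; apply: eq_bigr => i _; rewrite subrK.
have [PpN muNp] := muN _ N Pp; have [Pn mun] := mub zn; have [_] := mub zp.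
rewrite -NpE muD // mun addr0 muNp => /eqP; rewrite mulrn_eq0 eqn0Ngt N0 /=.
by move=> /eqP.
Qed.

End LinearExtension.

(** * Continuity along lines and relative interiors *)

Section Topology.
Variables (R : realType) (n : nat).
Implicit Types (x y d u : 'rV[R]_n).

Lemma continuous_pairing u : continuous (pairing u).
Proof.
move=> x; have FF : Filter (nbhs x) := nbhs_filter x.
apply: (@cvg_big _ _ _ _ _ _ _ (nbhs x)) => [|i _]; first exact: add_continuous.
apply: cvgM; first exact: cvg_cst.
exact: coord_continuous.
Qed.

(** The filter of neighbourhoods of a matrix is given by boxes, so this is
    continuity entry by entry. *)
Lemma continuous_line x d : continuous (fun t : R => x + t *: d).
Proof.
move=> t U [P nP sPU]; rewrite nbhs_simpl /=.
suff : \forall t' \near t, forall i j, P i j ((x + t' *: d) i j).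
  by apply: filterS => t' /sPU.
apply: (@filter_forall _ _ _ (nbhs t)) => i.
apply: (@filter_forall _ _ _ (nbhs t)) => j.
have : (fun t' => (x + t' *: d) i j) @ t --> (x + t *: d) i j.
  rewrite mxE [(t *: d) i j]mxE; under eq_fun do rewrite mxE [(_ *: d) i j]mxE.
  apply: cvgD; first exact: cvg_cst.
  by apply: cvgM; [exact: cvg_id | exact: cvg_cst].
by apply; exact: nP.
Qed.

(** The segment from a point [y] of [F] to a point [x] of the relative interior
    can be prolonged beyond [x] inside [F]: the prolongation stays in the affine
    hull of [F], in which [F] is a neighbourhood of [x]. *)
Lemma relint_extend (F : set 'rV[R]_n) x y : relint F x -> F y ->
  exists2 e : R, 0 < e & F (x + e *: (x - y)).
Proof.
move=> [Fx nF] Fy.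
have := @continuous_line x (x - y) 0; rewrite /continuous_at scale0r addr0.
move=> /(_ _ nF) /nbhs_ballP[r /= r0 rF].
exists (r / 2); first by rewrite divr_gt0.
apply: rF.
  rewrite -ball_normE /= sub0r normrN ger0_norm; last by rewrite divr_ge0 // ltW.
  by rewrite ltr_pdivrMr // ltr_pMr // ltr1n.
exists 2%N, (fun i => if i == 0 then x else y).
exists (fun i => if i == 0 then 1 + r / 2 else - (r / 2)).
split=> [i||]; rewrite ?big_ord_recl ?big_ord0 /=.
- by case: ifP.
- by rewrite addr0 addrK.
- by rewrite addr0 scalerDl scale1r scaleNr scalerBr addrA.
Qed.

End Topology.

(** * Extension of a homomorphism from the lattice points *)

Section Extension.
Variables (R : realType) (n : nat) (s : set 'rV[R]_n) (f : 'rV[R]_n -> R).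
Hypotheses (rs : rational_cone s) (f_ge0 : forall x, 0 <= f x) (f0 : f 0 = 1).
Hypothesis fD : forall x y, Ssemigroup s x -> Ssemigroup s y ->
  f (x + y) = f x * f y.

Let S := Ssemigroup s.
Let P : set 'rV[R]_n := [set p | S p /\ 0 < f p].

Let S0 : S 0. Proof. by split; [exact: dual0 | exact: lattice0]. Qed.
Let SD x y : S x -> S y -> S (x + y).
Proof. by move=> [? ?] [? ?]; split; [exact: dualD | exact: latticeD]. Qed.

Let P0 : P 0. Proof. by split; rewrite ?f0. Qed.
Let PD x y : P x -> P y -> P (x + y).
Proof. by move=> [Sx fx] [Sy fy]; split; [exact: SD | rewrite fD // mulr_gt0]. Qed.
Let PZ (N : nat) x : P x -> P (N%:R *: x).
Proof.
move=> Px; elim: N => [|N IH]; first by rewrite scale0r.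
by rewrite mulrS scalerDl scale1r; exact: PD.
Qed.

(** Rounding up the real coefficients of [q] to integers gives a lattice point
    that is still in [P]. *)
Lemma cone_hull_dominated q : cone_hull P q -> exists2 p, P p & dual s (p - q).
Proof.
elim=> [|a p x a0 Pp _ [p' Pp' dp']].
  by exists 0; rewrite ?subr0 //; exact: dual0.
exists ((Num.bound a)%:R *: p + p'); first by apply: PD => //; exact: PZ.
rewrite opprD addrACA -scalerBl; apply: dualD => //; apply: dualZ.
  by rewrite subr_ge0 ltW // archi_boundP.
by case: Pp => -[].
Qed.

(** Replace [q] by a dominating [p] in [P] and clear the coefficient [a]: for
    a large integer N, the vector N p - g is a lattice point of the dual, and
    f(N p) = f(N p - g) f(g) is positive. *)
Lemma positive_of_dominated q a g : cone_hull P q -> 0 < a -> S g ->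
  dual s (q - a *: g) -> P g.
Proof.
move=> /cone_hull_dominated[p Pp dpq] a0 Sg dqg; split=> //.
pose N := Num.bound a^-1.
have Na : a^-1 <= N%:R by rewrite ltW // archi_boundP // invr_ge0 ltW.
have {dpq dqg} dpg : dual s (p - a *: g).
  by rewrite -[p](subrK q) -addrA; exact: dualD.
have SNg : S (N%:R *: p - g).
  split; last first.
    apply: latticeD; last by apply: latticeN; case: Sg.
    by apply: latticeZnat; case: Pp => -[].
  have -> : N%:R *: p - g = N%:R *: (p - a *: g) + (N%:R * a - 1) *: g.
    by rewrite scalerBr scalerA scalerBl scale1r addrA subrK.
  apply: dualD; first exact: dualZ.
  by apply: dualZ; [rewrite subr_ge0 -ler_pdivrMr // mul1r | case: Sg].
have [_] := PZ N Pp; rewrite -[N%:R *: p](subrK g) fD //.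
by rewrite lt_def mulf_eq0 negb_or => /andP[/andP[_ fg] _]; rewrite lt_def fg f_ge0.
Qed.

(** Peel off from [x] one lattice generator at a time; each is absorbed by
    [positive_of_dominated]. *)
Lemma cone_hull_face x y : dual s x -> dual s y -> cone_hull P (x + y) ->
  cone_hull P x.
Proof.
move=> /(dual_cone_hull_lattice rs) Sx.
elim: Sx y => [|a g z a0 Sg Sz IH] y dy Pxy.
  exact: cone_hull0.
have dag : dual s (a *: g) by apply: dualZ => //; case: Sg.
have dz := cone_hull_Ssemigroup_dual Sz.
have Pz : cone_hull P z.
  by apply: (IH (a *: g + y)); [exact: dualD | rewrite addrCA addrA].
move: a0; rewrite le_eqVlt => /predU1P[<-|a0]; first by rewrite scale0r add0r.
apply: cone_hull_step; [exact: ltW | | exact: Pz].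
apply: (positive_of_dominated Pxy a0 Sg).
by rewrite addrC -addrA addKr; exact: dualD.
Qed.

(** The extension is exp(w x) on the cone over [P] and 0 elsewhere, where [w]
    is the linear form that extends ln f. *)
Lemma hom_c_extension : exists2 g : dual s -> R, hom_c (dual s) g &
  forall x, S (set_val x) -> g x = f (set_val x).
Proof.
have [w wE] : exists w, forall p, P p -> ln (f p) = pairing w p.
  apply: additive_on_lattice_linear => // [p [[]]//|p q [Sp fp] [Sq fq]].
  by rewrite fD // lnM // posrE.
pose g (x : dual s) : R :=
  if `[< cone_hull P (set_val x) >] then expR (pairing w (set_val x)) else 0.
have dval (x : dual s) : dual s (set_val x) by apply: set_valP.
exists g => [|x Sx]; last first.
  rewrite /g; case: asboolP => [hx|nhx].
    have Px : P (set_val x).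
      apply: (positive_of_dominated hx ltr01 Sx).
      by rewrite scale1r subrr; exact: dual0.
    by rewrite -wE // lnK // posrE; case: Px.
  apply/eqP; rewrite eq_sym; apply: contra_notT nhx => fx.
  by apply: sub_cone_hull; split=> //; rewrite lt_def fx f_ge0.
split=> [|F faceF].
  split=> [x|x x0|x y z zE]; rewrite /g.
  - by case: ifP => // _; exact: expR_ge0.
  - rewrite x0 pairing0r expR0; case: asboolP => // -[]; exact: cone_hull0.
  - rewrite zE; have dx := dval x; have dy := dval y.
    case: asboolP => [hxy|nhxy].
      have hx := cone_hull_face dx dy hxy.
      move: hxy; rewrite addrC => /(cone_hull_face dy dx) hy.
      by rewrite !asboolT // addrC pairingDr expRD mulrC.
    case: asboolP => hx; last by rewrite mul0r.
    case: asboolP => hy; last by rewrite mulr0.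
    by case: nhxy; exact: cone_hullD.
have Fdual : F `<=` dual s by move: faceF => [u _ ->] x [].
(* If x lies in the cone over P, so does the sum (1 + e) x of e y and a point
   of F, hence e y. *)
have constF x y : relint F x -> relint F y -> cone_hull P x -> cone_hull P y.
  move=> rFx [Fy _] hx; have [e e0 Fe] := relint_extend rFx Fy.
  have : cone_hull P (e *: y + (x + e *: (x - y))).
    rewrite scalerBr addrC -addrA subrK -[X in X + _]scale1r -scalerDl.
    by apply: cone_hullZ => //; rewrite addr_ge0 // ltW.
  move=> /cone_hull_face -/(_ (dualZ (ltW e0) (Fdual _ Fy)) (Fdual _ Fe)) hy.
  rewrite -[y]scale1r -(mulVf (lt0r_neq0 e0)) -scalerA.
  by apply: cone_hullZ => //; rewrite invr_ge0 ltW.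
have [[x0 rx0 hx0]|nh] := pselect (exists2 x, relint F x & cone_hull P x).
  apply: (@subspace_eq_continuous _ _ _
    (fun x : dual s => expR (pairing w (set_val x)))) => [x|].
    rewrite inE /= => rx; rewrite /from_subspace /g asboolT //; exact: constF hx0.
  apply: continuous_subspaceT => x; apply: continuous_comp; last first.
    exact: continuous_expR.
  apply: continuous_comp; last exact: continuous_pairing.
  exact: (@initial_continuous (dual s) _ set_val).
apply: (@subspace_eq_continuous _ _ _ (fun x : dual s => 0)) => [x|].
  rewrite inE /= => rx; rewrite /from_subspace /g asboolF // => hx.
  by apply: nh; exists (set_val x).
by apply: continuous_subspaceT; exact: cst_continuous.
Qed.

End Extension.

(** * Uniqueness of the extension *)

Section Rays.
Variables (R : realType) (n : nat).
Implicit Types (s : set 'rV[R]_n) (x y g : 'rV[R]_n).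

(** The face is the smallest one through [g], cut out by the sum of the
    generators of [s] orthogonal to [g]. On its affine hull these generators
    vanish, and the others stay positive near the ray. *)
Lemma relint_ray s g : polyhedral_cone s -> dual s g ->
  exists2 F, is_face F (dual s) & forall t : R, 0 < t -> relint F (t *: g).
Proof.
move=> [k [v ->]]; move: (cone_of v) (@dual_cone_of R n k v) => s' dualP dg.
have vg_ge0 := (dualP g).1 dg.
pose u := \sum_(j | pairing (v j) g == 0) v j.
pose F : set 'rV[R]_n := [set x | dual s' x /\ pairing u x = 0].
have uv x : dual s' x -> pairing u x = 0 <->
    (forall j, pairing (v j) g = 0 -> pairing (v j) x = 0).
  move=> /dualP vx; rewrite /u pairing_suml; split=> [ux0 j vg0|vx0].
    apply: (psumr_eq0P _ ux0) => [i _|]; [exact: vx | exact/eqP].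
  by apply: big1 => j /eqP; exact: vx0.
exists F => [|t t0].
  exists u => // x dx; rewrite /u pairing_suml; apply: sumr_ge0 => j _.
  exact: (dualP x).1.
have vtg j : pairing (v j) (t *: g) = t * pairing (v j) g by rewrite pairingZr.
have dtg : dual s' (t *: g) by apply: dualZ => //; exact: ltW.
split; first by split=> //; apply/uv => // j vg0; rewrite vtg vg0 mulr0.
have near_pos : \forall z \near t *: g,
    forall j, 0 < pairing (v j) g -> 0 < pairing (v j) z.
  apply: (@filter_forall _ _ _ (nbhs (t *: g))) => j.
  have [vg|_] := ltP 0 (pairing (v j) g); last by apply: nearW.
  apply: filterS (cvgr_gt _ (@continuous_pairing R n (v j) (t *: g)) 0 _) => //.
  by rewrite vtg mulr_gt0.
apply: filterS near_pos => z zpos [m [a [c [Fa _ zE]]]].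
have vz0 j : pairing (v j) g = 0 -> pairing (v j) z = 0.
  move=> vg0; rewrite zE pairing_sumr; apply: big1 => i _; rewrite pairingZr.
  by have [da ua] := Fa i; rewrite ((uv _ da).1 ua) // mulr0.
have dz : dual s' z.
  apply/dualP => j; have := vg_ge0 j; rewrite le_eqVlt => /predU1P[vg0|/zpos/ltW//].
  by rewrite vz0.
by split=> //; apply/uv.
Qed.

Lemma valL_set_val (C : set 'rV[R]_n) (f : C -> R) (x : C) :
  'valL_0 f (set_val x) = f x.
Proof. exact: (congr1 (@^~ x) (valLK 0 f)). Qed.

(** The open ray through [g] stays in the relative interior of one face, where
    [phi] is continuous. *)
Lemma continuous_ray s (phi : dual s -> R) g (t : R) :
  polyhedral_cone s -> hom_c (dual s) phi -> dual s g -> 0 < t ->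
  {for t, continuous (fun t : R => 'valL_0 phi (t *: g))}.
Proof.
move=> ps [_ cphi] dg t0; have [F faceF rF] := relint_ray ps dg.
have dt t' : 0 < t' -> dual s (t' *: g).
  by move=> t'0; apply: dualZ => //; exact: ltW.
pose p t' (t'0 : 0 < t') : dual s := exist _ (t' *: g) (mem_set (dt t' t'0)).
have pE t' (t'0 : 0 < t') : 'valL_0 phi (t' *: g) = phi (p t' t'0).
  exact: (valL_set_val phi (p t' t'0)).
have /subspace_continuousP/(_ (p t t0) (rF t t0)) := cphi F faceF.
move=> cp U; rewrite (pE t t0) => /cp [_ /= [[O oO <-] /= Op OU]].
have := @continuous_line R n 0 g t O; rewrite add0r.
move=> /(_ (open_nbhs_nbhs (conj oO Op))).
apply: filterS2 (lt_nbhsr t0) => t' t'0 /=; rewrite add0r => Ot'.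
suff : U (phi (p t' t'0)) by rewrite -(pE t' t'0).
by apply: OU => //; exact: rF.
Qed.

(** Homomorphisms are extended by 0 to the whole space, with ['valL_0], so that
    their values at sums and multiples can be written without membership
    proofs. *)
Lemma hom_mon_valL (C : set 'rV[R]_n) (phi : C -> R) : hom_mon C phi ->
  [/\ forall x, 0 <= 'valL_0 phi x, C 0 -> 'valL_0 phi 0 = 1 &
    forall x y, C x -> C y -> C (x + y) ->
    'valL_0 phi (x + y) = 'valL_0 phi x * 'valL_0 phi y].
Proof.
move=> [phi_ge0 phi0 phiD].
have valE x (Cx : C x) : 'valL_0 phi x = phi (exist _ x (mem_set Cx)).
  exact: (valL_set_val phi (exist _ x (mem_set Cx))).
split=> [x|C0|x y Cx Cy Cxy].
- have [Cx|nCx] := pselect (C x); first by rewrite (valE _ Cx).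
  by rewrite /valL_ /= oinv_set_val insubN //; apply/negP => /set_mem.
- by rewrite (valE _ C0) phi0.
- by rewrite (valE _ Cx) (valE _ Cy) (valE _ Cxy); exact: phiD.
Qed.

Lemma hom_mon_valLX s (phi : dual s -> R) x (N : nat) :
  hom_mon (dual s) phi -> dual s x ->
  'valL_0 phi (N%:R *: x) = 'valL_0 phi x ^+ N.
Proof.
move=> /hom_mon_valL[_ phi0 phiD] dx; elim: N => [|N IH].
  by rewrite scale0r phi0 //; exact: dual0.
have dN : dual s (N%:R *: x) by apply: dualZ.
by rewrite mulrS scalerDl scale1r phiD ?IH ?exprS //; exact: dualD.
Qed.

(** Two homomorphisms that agree at lattice points agree at rational multiples
    of a lattice point by uniqueness of nonnegative roots, at real multiples by
    continuity along the ray, and at all points of the dual because it is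
    generated by such multiples. The two cones may differ, since gluing
    compares homomorphisms in different charts. *)
Lemma hom_c_eq_on_dual s s' (phi : dual s -> R) (phi' : dual s' -> R) :
  rational_cone s -> rational_cone s' -> dual s `<=` dual s' ->
  hom_c (dual s) phi -> hom_c (dual s') phi' ->
  {in Ssemigroup s, 'valL_0 phi =1 'valL_0 phi'} ->
  {in dual s, 'valL_0 phi =1 'valL_0 phi'}.
Proof.
move=> rs rs' ss' cphi cphi' eqS x /set_mem dx.
have poly (r : set 'rV[R]_n) : rational_cone r -> polyhedral_cone r.
  by move=> [k [v _ vE]]; exists k, v.
have [mphi _] := cphi; have [mphi' _] := cphi'.
have [phi_ge0 phi0 phiD] := hom_mon_valL mphi.
have [phi'_ge0 phi'0 phi'D] := hom_mon_valL mphi'.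
have rat_ray g (q : rat) : Ssemigroup s g -> 0 < q ->
    'valL_0 phi (ratr q *: g) = 'valL_0 phi' (ratr q *: g).
  move=> [dg lg] q0; pose d := `|denq q|%N; pose m := `|numq q|%N.
  have d0 : (0 < d)%N by rewrite absz_gt0.
  have qE : d%:R * ratr q = m%:R :> R.
    rewrite -(ratr_nat R d) -rmorphM /= mulrC.
    rewrite [d%:R](_ : _ = (denq q)%:~R); last by rewrite -[denq q]gez0_abs.
    by rewrite -numqE ratr_int -[numq q]gez0_abs // numq_ge0 ltW.
  have dq : dual s (ratr q *: g) by apply: dualZ => //; rewrite ler0q ltW.
  apply/eqP; rewrite -(eqrXn2 d0) // -!hom_mon_valLX //; last exact: ss'.
  rewrite !scalerA qE; apply/eqP/eqS/mem_set.
  by split; [exact: dualZ | exact: latticeZnat].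
have ray g (t : R) : Ssemigroup s g -> 0 <= t ->
    'valL_0 phi (t *: g) = 'valL_0 phi' (t *: g).
  move=> Sg; have [dg lg] := Sg; rewrite le_eqVlt => /predU1P[<-|t0].
    by rewrite scale0r phi0 ?phi'0 //; exact: dual0.
  apply/eqP; rewrite -subr_eq0; apply: contraT => neq.
  have cont := continuousB (continuous_ray (poly _ rs) cphi dg t0)
                 (continuous_ray (poly _ rs') cphi' (ss' _ dg) t0).
  (* If the values differ at t, they differ at a rational number near t. *)
  have /nbhs_ballP[e /= e0 eP] : \forall t' \near t,
      'valL_0 phi (t' *: g) - 'valL_0 phi' (t' *: g) != 0.
    exact: (cvgr_neq0 _ cont neq).
  have /rat_in_itvoo[q] : t < t + e by rewrite ltrDl.
  rewrite in_itv /= => /andP[tq qe].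
  have /eqP[] : 'valL_0 phi (ratr q *: g) - 'valL_0 phi' (ratr q *: g) != 0.
    apply: eP; rewrite -ball_normE /= ltr_norml; lra.
  by apply/eqP; rewrite subr_eq0 rat_ray // -(ltr0q R) (lt_trans t0).
elim: (dual_cone_hull_lattice rs dx) => [|a g z a0 Sg Sz IH].
  by rewrite phi0 ?phi'0 //; exact: dual0.
have dag : dual s (a *: g) by apply: dualZ => //; case: Sg.
have dz := cone_hull_Ssemigroup_dual Sz.
have dagz := dualD dag dz.
by rewrite phiD // phi'D ?IH ?ray //; exact: ss'.
Qed.

End Rays.

(** * Maps between glued spaces *)

Section GluedMaps.

Lemma glue_inP T (r : T -> T -> Prop) x y :
  glue_in r x = glue_in r y <-> clos_refl_sym_trans T r x y.
Proof.
by rewrite /glue_in; split=> [/eqquotP/asboolP|xy]; last exact/eqquotP/asboolP.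
Qed.

Lemma glue_in_surj T (r : T -> T -> Prop) (q : glued r) :
  exists x, q = glue_in r x.
Proof. by exists (repr q); rewrite /glue_in reprK. Qed.

Lemma glued_map T T' (r : T -> T -> Prop) (r' : T' -> T' -> Prop) (h : T -> T') :
  (forall x y, r x y -> r' (h x) (h y)) ->
  exists f : glued r -> glued r', forall x, f (glue_in r x) = glue_in r' (h x).
Proof.
move=> rr'; exists (fun q => glue_in r' (h (repr q))) => x; apply/glue_inP.
have : clos_refl_sym_trans T r (repr (glue_in r x)) x.
  by apply/glue_inP; rewrite /glue_in reprK.
move: (repr _) => x'; elim=> [y z /rr'|y|y z _|y z w _ + _].
- exact: rst_step.
- exact: rst_refl.
- exact: rst_sym.
- exact: rst_trans.
Qed.

Lemma glued_bij T T' (r : T -> T -> Prop) (r' : T' -> T' -> Prop) (h : T -> T') :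
  bijective h -> (forall x y, r x y <-> r' (h x) (h y)) ->
  exists2 f : glued r -> glued r', bijective f &
    forall x, f (glue_in r x) = glue_in r' (h x).
Proof.
move=> [h' hK h'K] rr'.
have [f fE] := glued_map (fun x y => (rr' x y).1).
have [f' f'E] : exists f' : glued r' -> glued r,
    forall x, f' (glue_in r' x) = glue_in r (h' x).
  by apply: glued_map => x y; rewrite rr' !h'K.
exists f => //; exists f' => q; have [x ->] := glue_in_surj q.
  by rewrite fE f'E hK.
by rewrite f'E fE h'K.
Qed.

Lemma tagged_map_bij (I : Type) (A B : I -> Type) (h : forall i, A i -> B i) :
  (forall i, bijective (h i)) ->
  bijective (fun p : {i & A i} => existT B (tag p) (h (tag p) (tagged p))).
Proof.
move=> bij_h.
have hV i : {g : B i -> A i | cancel (h i) g /\ cancel g (h i)}.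
  by apply: cid; have [g hK gK] := bij_h i; exists g.
exists (fun p : {i & B i} => existT A (tag p) (sval (hV (tag p)) (tagged p))).
  by move=> [i a] /=; case: (hV i) => g [/= hK _]; rewrite hK.
by move=> [i b] /=; case: (hV i) => g [/= _ gK]; rewrite gK.
Qed.

End GluedMaps.

(** * Restriction to the lattice on charts *)

Section Charts.
Variables (R : realType) (n : nat).
Implicit Types (s t : set 'rV[R]_n).

Lemma restrict_latticeE s (phi : Vchart s) x : Ssemigroup s x ->
  'valL_0 (set_val (restrict_lattice phi)) x = 'valL_0 (set_val phi) x.
Proof.
move=> Sx; pose y : Ssemigroup s := exist _ x (mem_set Sx).
rewrite (valL_set_val (set_val (restrict_lattice phi)) y).
by rewrite (valL_set_val (set_val phi) (Ssemigroup_incl y)).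
Qed.

Lemma is_restrictionP (A B : set 'rV[R]_n) (phi : B -> R) (psi : A -> R) :
  A `<=` B -> is_restriction phi psi <-> {in A, 'valL_0 psi =1 'valL_0 phi}.
Proof.
move=> AB; split=> [res x xA|eqA x y xy].
  have xB : x \in B by move: xA => /set_mem/AB/mem_set.
  rewrite (valL_set_val psi (exist _ x xA)) (valL_set_val phi (exist _ x xB)).
  exact: res.
by rewrite -!valL_set_val -xy eqA //; exact: valP.
Qed.

Lemma restrict_lattice_bij s : rational_cone s ->
  bijective (@restrict_lattice R n s).
Proof.
move=> rs; rewrite -setTT_bijective; split=> // [phi phi' _ _ eq_res|psi _].
  apply/val_inj/funext => x; rewrite -!(valL_set_val (_ : dual s -> R)).
  have cphi := set_mem (valP phi); have cphi' := set_mem (valP phi').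
  apply: (hom_c_eq_on_dual rs rs) cphi cphi' _ _ _ => //.
  by move=> y /set_mem Sy; rewrite -!restrict_latticeE // eq_res.
have [psi_ge0 psi0 psiD] := hom_mon_valL (set_mem (valP psi)).
have S0 : Ssemigroup s 0 by split; [exact: dual0 | exact: lattice0].
have [g cg gE] : exists2 g : dual s -> R, hom_c (dual s) g &
    forall x, Ssemigroup s (set_val x) -> g x = 'valL_0 (set_val psi) (set_val x).
  apply: hom_c_extension => // [|x y Sx Sy]; first exact: psi0.
  apply: psiD => //; split; first by apply: dualD; [case: Sx | case: Sy].
  by apply: latticeD; [case: Sx | case: Sy].
exists (exist _ g (mem_set cg)) => //; apply/val_inj/funext => x.
transitivity (g (Ssemigroup_incl x)) => //.
have Sx : Ssemigroup s (set_val x) := set_valP x.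
by rewrite gE //; exact: (valL_set_val (val psi) x).
Qed.

(** That the gluing relation can be tested on lattice points is the uniqueness
    of the extension, applied to [psi] and to [phi] restricted to the smaller
    dual. *)
Lemma is_restriction_lattice s t (phi : Vchart t) (psi : Vchart s) :
  rational_cone s -> rational_cone t -> t `<=` s ->
  is_restriction (set_val phi) (set_val psi) <->
  is_restriction (set_val (restrict_lattice phi)) (set_val (restrict_lattice psi)).
Proof.
move=> rs rt ts; have dst := dualS ts.
have Sst : Ssemigroup s `<=` Ssemigroup t by move=> x [/dst].
rewrite !is_restrictionP //; split=> [eqd x /set_mem Sx|eqS].
  rewrite !restrict_latticeE //; last exact: Sst.
  by apply/eqd/mem_set; case: Sx.
apply: (hom_c_eq_on_dual rs rt dst (set_mem (valP psi)) (set_mem (valP phi))).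
move=> x xS; have Sx := set_mem xS.
by rewrite -!restrict_latticeE ?eqS //; exact: Sst.
Qed.

End Charts.

Theorem theorem3p14 (R : realType) (n : nat) (Sigma : set (set 'rV[R]_n)) :
  rational_fan Sigma ->
  (forall s : set 'rV[R]_n, Sigma s ->
     bijective (@restrict_lattice R n s)) /\
  exists2 f : irrational_toric_variety Sigma -> nonneg_toric_variety Sigma,
    bijective f &
    forall (s : Sigma) (phi : Vchart (set_val s)),
      f (Vin phi) = Xin (restrict_lattice phi).
Proof.
move=> [_ rS]; have bij s : Sigma s -> bijective (@restrict_lattice R n s).
  by move=> /rS; exact: restrict_lattice_bij.
split=> //.
pose h (p : Vpoints Sigma) : Xpoints Sigma :=
  existT (fun s : Sigma => Xchart (set_val s) : Type) (tag p)
    (restrict_lattice (tagged p)).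
have [|p q|f bij_f fE] := @glued_bij _ _ (@Vglue R n Sigma) (@Xglue R n Sigma) h.
- apply: (@tagged_map_bij Sigma _ _
    (fun s : Sigma => @restrict_lattice R n (set_val s))) => s.
  by apply: bij; exact: set_valP.
- have face_sub : is_face (set_val (tag p)) (set_val (tag q)) ->
      set_val (tag p) `<=` set_val (tag q) by move=> [u _ ->] x [].
  have rat s : rational_cone (set_val (s : Sigma)) by apply/rS/set_valP.
  by split=> -[faceF res]; split=> //; apply/is_restriction_lattice => //;
    exact: face_sub.
- by exists f => // s phi; exact: fE.
Qed.
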